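(* Let $0\le k\le n-2$. Every positroid tiling of the hypersimplex $\Delta_{k+1,n}$ consists of exactly $\binom{n-2}{k}$ tiles.
   Context: For $x\in\mathbb R^n$ and $S\subseteq[n]$ write $x_S=\sum_{i\in S}x_i$; for $i\ne j$ in $[n]$, $[i,j]=\{i,i+1,\dots,j\}$ is the cyclic interval (indices mod $n$). The hypersimplex is $\Delta_{k+1,n}=\mathrm{conv}\{e_I : I\in\binom{[n]}{k+1}\}\subset\mathbb R^n$, where $e_I=\sum_{i\in I}e_i$. Let $\mathbf P_n$ be a convex $n$-gon with vertices labeled $1,\dots,n$ clockwise. A bicolored subdivision $\sigma$ of $\mathbf P_n$ is a partition of $\mathbf P_n$ into polygons (with vertices among those of $\mathbf P_n$) colored black or white so that two polygons sharing an edge have different colors; it has type $(k,n)$ if any triangulation of its black polygons has exactly $k$ triangles. For vertices $i\neq j$, the arc $i\to j$ is compatible with $\sigma$ if the chord $(i,j)$ is an edge of a polygon of $\sigma$ or lies inside a polygon of $\sigma$; the region to the left of $i\to j$ is the part of $\mathbf P_n$ cut off by the chord $(i,j)$ that contains the vertices $i+1,\dots,j-1$; for compatible $i\to j$, $\mathrm{area}(i\to j)$ is the number of black triangles to the left of $i\to j$ in any triangulation of the black polygons. For $\sigma$ of type $(k,n)$, the positroid tile $\Gamma_\sigma\subset\mathbb R^n$ is $\{x: x_{[n]}=k+1,\ \mathrm{area}(i\to j)\le x_{[i,j-1]}\le \mathrm{area}(i\to j)+1 \text{ for all compatible arcs } i\to j\}$. (These are exactly the closures of moment-map images of $(n-1)$-dimensional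 positroid cells of $\mathrm{Gr}^{\ge0}_{k+1,n}$ on which the moment map is injective.) A positroid tiling of $\Delta_{k+1,n}$ is a collection of such tiles $\Gamma_\sigma$ with pairwise disjoint interiors whose union is $\Delta_{k+1,n}$. *)

(* Defs.v *)
From HB Require Import structures.
From mathcomp Require Import all_boot all_order all_algebra.
From mathcomp Require Import all_classical all_reals all_analysis.

Set Implicit Arguments.
Unset Strict Implicit.
Unset Printing Implicit Defensive.

Import Order.TTheory GRing.Theory Num.Theory.
Import numFieldNormedType.Exports.

(* The vertices 1, ..., n of the convex n-gon are the elements 0, ..., n-1 of
   'I_n, in clockwise order; a polygon is given by its set of vertices. *)

Section Polygons.
Context {n : nat}.
Implicit Types (i j v : 'I_n) (S A B t : {set 'I_n}) (F T : {set {set 'I_n}}).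

(* [i, j] = {i, i+1, ..., j} modulo n: the vertices met going clockwise from i
   no later than j; [i, i] = {i}. *)
Definition cyc_itv i j : {set 'I_n} :=
  [set v : 'I_n | (v + (n - i)) %% n <= (j + (n - i)) %% n]%SET.

(* The partitions F of the convex polygon S into polygons with vertices in S.
   Such a partition is obtained by cutting repeatedly along diagonals (i, j),
   those chords having a vertex of S strictly on either side.  The segment
   (#|S| = 2) counts as an indivisible degenerate polygon; it occurs only as
   the whole "2-gon" when n = 2. *)
Inductive dissection : {set 'I_n} -> {set {set 'I_n}} -> Prop :=
| dissection_whole S : 2 <= #|S| -> dissection S [set S]%SET
| dissection_cut S i j F1 F2 :
    i \in S -> j \in S -> i != j ->
    2 < #|S :&: cyc_itv i j| -> 2 < #|S :&: cyc_itv j i| ->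
    dissection (S :&: cyc_itv i j) F1 ->
    dissection (S :&: cyc_itv j i) F2 ->
    dissection S (F1 :|: F2).

Definition polygon_edge S i j : Prop :=
  [/\ i \in S, j \in S, i != j &
      S :&: cyc_itv i j = [set i; j]%SET \/ S :&: cyc_itv j i = [set i; j]%SET].

Definition share_edge A B : Prop :=
  exists i j, polygon_edge A i j /\ polygon_edge B i j.

Definition triangulation S T : Prop :=
  dissection S T /\ (forall t, t \in T -> #|t| <= 3).

Definition triangles T : {set {set 'I_n}} := [set t in T | #|t| == 3]%SET.

End Polygons.

Record bicolored_subdivision (n : nat) := BicoloredSubdivision {
  black : {set {set 'I_n}};
  white : {set {set 'I_n}};
  black_white_disjoint : [disjoint black & white];
  bicolored_dissection : dissection [set: 'I_n]%SET (black :|: white);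
  bicolored_adjacent : forall A B : {set 'I_n},
    A \in black :|: white -> B \in black :|: white -> A != B ->
    share_edge A B -> (A \in black) != (B \in black)
}.

Section Subdivisions.
Context {n : nat} (sigma : bicolored_subdivision n).
Implicit Types (i j : 'I_n) (T : {set {set 'I_n}}).

Definition black_triangulation T : Prop :=
  exists2 tr : {set 'I_n} -> {set {set 'I_n}},
    (forall B, B \in black sigma -> triangulation B (tr B)) &
    T = (\bigcup_(B in black sigma) tr B)%SET.

Definition has_type (k : nat) : Prop :=
  forall T, black_triangulation T -> #|triangles T| = k.

(* A chord whose two endpoints are vertices of the convex polygon A is either
   an edge of A or lies inside A. *)
Definition compatible_arc i j : Prop :=
  i != j /\
  exists2 A : {set 'I_n}, A \in black sigma :|: white sigma &
                          i \in A /\ j \in A.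

Definition chord_avoids T i j : Prop :=
  forall t, t \in T -> t \subset cyc_itv i j \/ t \subset cyc_itv j i.

(* When the chord (i, j) lies inside a black polygon, only the triangulations
   that it does not cut through split into a left and a right part. *)
Definition is_area i j (a : nat) : Prop :=
  forall T, black_triangulation T -> chord_avoids T i j ->
    #|[set t in triangles T | t \subset cyc_itv i j]%SET| = a.

End Subdivisions.

Local Open Scope ring_scope.
Local Open Scope classical_set_scope.

Section Hypersimplex.
Context {R : realType}.

Definition coord_sum {n : nat} (x : 'rV[R]_n) (S : {set 'I_n}) : R :=
  \sum_(i in S) x ord0 i.

Definition indicator_vec {n : nat} (I : {set 'I_n}) : 'rV[R]_n :=
  \row_i (i \in I)%:R.

(* The convex hull of the vectors e_I, #|I| = m. *)
Definition hypersimplex {n : nat} (m : nat) : set 'rV[R]_n :=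
  [set x | exists w : {set 'I_n} -> R,
    [/\ forall I : {set 'I_n}, #|I| = m -> 0 <= w I,
        \sum_(I : {set 'I_n} | #|I| == m) w I = 1 &
        x = \sum_(I : {set 'I_n} | #|I| == m) w I *: indicator_vec I]].

Definition tile {n : nat} (k : nat) (sigma : bicolored_subdivision n) :
    set 'rV[R]_n :=
  [set x | coord_sum x [set: 'I_n]%SET = k.+1%:R /\
    forall (i j : 'I_n) (a : nat),
      compatible_arc sigma i j -> is_area sigma i j a ->
      a%:R <= coord_sum x (cyc_itv i (ord_pred j)) <= a%:R + 1].

(* Tiles lie in the hyperplane x_[n] = k+1, so their interiors are taken
   relative to it. *)
Definition tile_interior {n : nat} (k : nat) (G : set 'rV[R]_n) :
    set 'rV[R]_n :=
  let H := [set x : 'rV[R]_n | coord_sum x [set: 'I_n]%SET = k.+1%:R] in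
  [set x | H x /\ \forall y \near x, H y -> G y].

Definition positroid_tiling {n : nat} (k : nat) (T : set (set 'rV[R]_n)) : Prop :=
  [/\ forall G, T G ->
        exists2 sigma : bicolored_subdivision n,
          has_type sigma k & G = tile k sigma,
      trivIset T (tile_interior k) &
      \bigcup_(G in T) G = hypersimplex k.+1].

End Hypersimplex.

(* Main.v *)
Require Import Defs.
From HB Require Import structures.
From mathcomp Require Import all_boot all_order all_algebra.
From mathcomp Require Import all_classical all_reals all_analysis.
From mathcomp Require Import zify ring lra.

(* Each vertex 0 < v < n - 1 is the middle vertex (for the order of 'I_n) of
   exactly one triangle of a triangulation of the n-gon, so a subdivision sigma
   of type (k, n) determines the k-set B(sigma) of middle vertices of its black
   triangles, and area(i -> j) is the number of elements of B(sigma) in ]i, j[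
   for every compatible arc with i < j.  To each k-subset S of {1, ..., n - 2} we
   attach a point p_S whose partial sums x_[i,j-1], i < j, have integral part
   #|S :&: ]i, j[| and are not integers.  Hence p_S belongs to the tile of sigma
   iff S = B(sigma), and then it is an interior point.  In a tiling, every p_S
   lies in exactly one tile and every tile contains exactly one p_S. *)

Set Implicit Arguments.
Unset Strict Implicit.
Unset Printing Implicit Defensive.

Import Order.TTheory GRing.Theory Num.Theory.
Import numFieldNormedType.Exports.

(** * Polygon dissections and middle vertices *)

Section Dissections.
Context {n : nat}.
Implicit Types (i j u v : 'I_n) (S A B t : {set 'I_n}) (F T : {set {set 'I_n}}).

Lemma in_cyc_itv i j v :
  (v \in cyc_itv i j) = if i <= j then i <= v <= j else (i <= v) || (v <= j).
Proof.
have sh (w : 'I_n) : (w + (n - i)) %% n = if i <= w then w - i else w + (n - i).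
  have := ltn_ord i; have := ltn_ord w => ltw lti.
  case: leqP => iw.
    by rewrite (_ : w + (n - i) = (w - i) + n) ?modnDr ?modn_small; lia.
  by rewrite modn_small; lia.
rewrite inE !sh; have := ltn_ord i; have := ltn_ord j; have := ltn_ord v.
by case: (leqP i v); case: (leqP i j); lia.
Qed.

(** All vertices of [A] but the least and the greatest: the middle vertex if [A] is a triangle, and
    in general the middle vertices of the triangles in any triangulation of [A]. *)
Definition inner A : {set 'I_n} :=
  [set v in A | [exists a in A, a < v] && [exists c in A, v < c]]%SET.

Lemma innerP A v :
  reflect [/\ v \in A, exists2 a, a \in A & a < v & exists2 c, c \in A & v < c]
          (v \in inner A).
Proof.
rewrite inE; apply: (iffP and3P).
  by case=> vA /exists_inP[a aA av] /exists_inP[c cA vc]; split; [|exists a|exists c].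
by case=> vA [a aA av] [c cA vc]; split=> //; apply/exists_inP; [exists a|exists c].
Qed.

Lemma innerS A B : A \subset B -> inner A \subset inner B.
Proof.
move=> /fintype.subsetP sAB; apply/fintype.subsetP => v /innerP[vA [a aA av] [c cA vc]].
by apply/innerP; split; [exact: sAB | exists a => //; exact: sAB
                        | exists c => //; exact: sAB].
Qed.

Lemma inner_card_gt2 A v : v \in inner A -> 2 < #|A|.
Proof.
case/innerP=> vA [a aA av] [c cA vc].
have <- : #|[set a; v; c]%SET| = 3.
  by rewrite -finset.setUA cardsU1 cards2 !inE -!val_eqE /=; lia.
by apply/subset_leq_card/fintype.subsetP => u; rewrite !inE => /orP[/orP[]|] /eqP->.
Qed.

Lemma inner_triangle t : #|t| = 3 -> exists v, inner t = [set v]%SET.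
Proof.
move=> t3.
have /card_gt0P[v vt] : 0 < #|inner t|.
  have /card_gt0P[x0 x0t] : 0 < #|t| by rewrite t3.
  have [a aP amin] := arg_minnP (fun x : 'I_n => x : nat) x0t.
  have [c cP cmax] := arg_maxnP (fun x : 'I_n => x : nat) x0t.
  have : 0 < #|t :\: [set a; c]|.
    have := cardsD t [set a; c]; have := subset_leq_card (finset.subsetIr t [set a; c]).
    by rewrite cards2; case: (a != c); lia.
  case/card_gt0P=> b; rewrite !inE negb_or -!val_eqE /= => /andP[/andP[ba bc] bt].
  apply/card_gt0P; exists b; apply/innerP; split=> //.
    by exists a => //; have := amin _ bt; lia.
  by exists c => //; have := cmax _ bt; lia.
exists v; apply/finset.setP => u; rewrite finset.in_set1; apply/idP/eqP => [ut|->//].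
apply/eqP; rewrite -val_eqE /=; apply/negPn/negP => uv.
have /innerP[uA [a aA au] [c cA uc]] := ut.
have /innerP[vA [a' a'A av] [c' c'A vc]] := vt.
have le4 (p q r s : 'I_n) : p \in t -> q \in t -> r \in t -> s \in t ->
    p < q -> q < r -> r < s -> False.
  move=> pt qt rt st pq qr rs.
  have : #|[set p; q; r; s]%SET| <= #|t|.
    by apply/subset_leq_card/fintype.subsetP => w;
       rewrite !inE => /orP[/orP[/orP[]|]|] /eqP->.
  have pr := ltn_trans pq qr; have qs := ltn_trans qr rs; have ps := ltn_trans pq qs.
  by rewrite -!finset.setUA !cardsU1 cards1 t3 !inE -!val_eqE /= !ltn_eqF.
have [lt|lt|/val_inj eq] := ltngtP u v; last by rewrite eq eqxx in uv.
  exact: (le4 a u v c').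
exact: (le4 a' v u c).
Qed.

Lemma dissection_sub S F A : dissection S F -> A \in F -> A \subset S.
Proof.
move=> d; elim: d A => [S' _ A|S' i j F1 F2 _ _ _ _ _ _ IH1 _ IH2 A].
  by rewrite inE => /eqP->.
by rewrite inE => /orP[/IH1|/IH2] /fintype.subset_trans; apply; exact: finset.subsetIl.
Qed.

Lemma dissection_card S F A : dissection S F -> A \in F -> 2 <= #|A|.
Proof.
move=> d; elim: d A => [S' S2 A|S' i j F1 F2 _ _ _ _ _ _ IH1 _ IH2 A].
  by rewrite inE => /eqP->.
by rewrite inE => /orP[/IH1|/IH2].
Qed.

(** For a cut with ends p < q, an inner vertex of a piece inside [p, q] lies strictly between p and
    q, where no piece on the other side has a vertex. So pieces separated by a cut share no inner
    vertex. *)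
Lemma dissection_inner_inj S F A B v : dissection S F -> A \in F -> B \in F ->
  v \in inner A -> v \in inner B -> A = B.
Proof.
have cross i j (X Y : {set 'I_n}) : i != j ->
    X \subset cyc_itv i j -> Y \subset cyc_itv j i ->
    v \in inner X -> v \in inner Y -> False.
  rewrite -val_eqE /= => ij /fintype.subsetP sX /fintype.subsetP sY.
  move=> /innerP[/sX + [a /sX + av] [c /sX + vc]].
  move=> + + + /innerP[/sY + [a' /sY + av'] [c' /sY + vc']].
  rewrite !in_cyc_itv; case: (leqP i j) => leij; case: (leqP j i) => leji; lia.
move=> d; elim: d A B => [S' _ A B|S' i j F1 F2 _ _ ij _ _ d1 IH1 d2 IH2 A B].
  by rewrite !inE => /eqP-> /eqP->.
have s1 X : X \in F1 -> X \subset cyc_itv i j.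
  by move=> /(dissection_sub d1); rewrite finset.subsetI => /andP[].
have s2 X : X \in F2 -> X \subset cyc_itv j i.
  by move=> /(dissection_sub d2); rewrite finset.subsetI => /andP[].
rewrite !finset.in_setU => /orP[A1|A2] /orP[B1|B2] vA vB.
- exact: IH1.
- by case: (cross i j A B ij (s1 _ A1) (s2 _ B2)).
- by case: (cross i j B A ij (s1 _ B1) (s2 _ A2)).
- exact: IH2.
Qed.

Lemma inner_cut S (p q : 'I_n) v : p < q -> p \in S -> q \in S -> v \in inner S ->
  v \in inner (S :&: cyc_itv p q) \/ v \in inner (S :&: cyc_itv q p).
Proof.
move=> pq pS qS /innerP[vS [a aS av] [c cS vc]].
have inL (w : 'I_n) : w \in S -> (w \in S :&: cyc_itv p q) = (p <= w <= q).
  by move=> wS; rewrite finset.in_setI wS in_cyc_itv (ltnW pq).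
have inR (w : 'I_n) : w \in S -> (w \in S :&: cyc_itv q p) = (q <= w) || (w <= p).
  by move=> wS; rewrite finset.in_setI wS in_cyc_itv leqNgt pq.
have [vp|pv] := leqP v p.
  right; apply/innerP; rewrite inR // vp orbT; split=> //.
    by exists a; rewrite // inR // (ltnW (leq_trans av vp)) orbT.
  by exists q; rewrite ?inR ?leqnn // (leq_ltn_trans vp).
have [qv|vq] := leqP q v.
  right; apply/innerP; rewrite inR // qv; split=> //.
    by exists p; rewrite // inR // leqnn orbT.
  by exists c; rewrite // inR // (ltnW (leq_ltn_trans qv vc)).
left; apply/innerP; rewrite inL // (ltnW pv) (ltnW vq); split=> //.
  by exists p; rewrite // inL // leqnn ltnW.
by exists q; rewrite // inL // leqnn ltnW.
Qed.

Lemma dissection_inner_cover S F v : dissection S F -> v \in inner S ->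
  exists2 A, A \in F & v \in inner A.
Proof.
move=> d; elim: d => [S' _ vS|S' i j F1 F2 iS jS ij _ _ d1 IH1 d2 IH2 vS].
  by exists S'; rewrite ?finset.set11.
suff [/IH1[A A1 vA]|/IH2[A A2 vA]] :
    v \in inner (S' :&: cyc_itv i j) \/ v \in inner (S' :&: cyc_itv j i).
- by exists A; rewrite // inE A1.
- by exists A; rewrite // inE A2 orbT.
have [lt|lt|/val_inj eq] := ltngtP i j; last by rewrite eq eqxx in ij.
  exact: inner_cut.
by case: (inner_cut lt jS iS vS); auto.
Qed.

(** * Chords that do not cross *)

Lemma cyc_itv_noncrossing (p q i j : 'I_n) : p != q -> i != j ->
  i \in cyc_itv p q -> j \in cyc_itv p q ->
  cyc_itv q p \subset cyc_itv i j \/ cyc_itv q p \subset cyc_itv j i.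
Proof.
wlog ltij : i j / i < j.
  move=> wl pq ij iX jX.
  have [lt|lt|/val_inj eq] := ltngtP i j; first exact: wl.
    by rewrite eq_sym in ij; case: (wl j i lt pq ij jX iX); auto.
  by rewrite eq eqxx in ij.
rewrite -!val_eqE /= => pq _.
have jiF : (j <= i) = false by rewrite leqNgt ltij.
have [ltpq|] := ltnP p q; last rewrite leq_eqVlt eq_sym (negPf pq) /= => ltqp.
  have qpF : (q <= p) = false by rewrite leqNgt ltpq.
  rewrite !in_cyc_itv (ltnW ltpq) => iX jX; right; apply/fintype.subsetP => x.
  by rewrite !in_cyc_itv qpF jiF; lia.
have pqF : (p <= q) = false by rewrite leqNgt ltqp.
rewrite !in_cyc_itv pqF => iX jX.
(* The far arc is now the plain interval [q, p]; if it does not fit between i and j, these are both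
   at most q or both at least p. *)
have [/andP[iq pj]|no] := boolP ((i <= q) && (p <= j)); [left|right];
  apply/fintype.subsetP => x.
  by rewrite !in_cyc_itv (ltnW ltqp) (ltnW ltij); lia.
by rewrite !in_cyc_itv (ltnW ltqp) jiF; lia.
Qed.

(** The cut (p, q) that separates [A] from [B] leaves [B] in one of its arcs and both i and j in the
    other. *)
Lemma dissection_chord S F A B i j : dissection S F -> A \in F -> B \in F ->
  A != B -> i != j -> i \in A -> j \in A ->
  B \subset cyc_itv i j \/ B \subset cyc_itv j i.
Proof.
have cross p q (X Y : {set 'I_n}) : p != q -> i != j ->
    X \subset cyc_itv p q -> Y \subset cyc_itv q p ->
    i \in X -> j \in X -> Y \subset cyc_itv i j \/ Y \subset cyc_itv j i.
  move=> pq ij /fintype.subsetP sX sY /sX iX /sX jX.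
  by have [s|s] := cyc_itv_noncrossing pq ij iX jX; [left|right];
     apply: fintype.subset_trans s.
move=> d; elim: d A B => [S' _ A B|S' p q F1 F2 _ _ pq _ _ d1 IH1 d2 IH2 A B].
  by rewrite !inE => /eqP-> /eqP->; rewrite eqxx.
have s1 X : X \in F1 -> X \subset cyc_itv p q.
  by move=> /(dissection_sub d1); rewrite finset.subsetI => /andP[].
have s2 X : X \in F2 -> X \subset cyc_itv q p.
  by move=> /(dissection_sub d2); rewrite finset.subsetI => /andP[].
rewrite !finset.in_setU => /orP[A1|A2] /orP[B1|B2] AB ij iA jA.
- exact: (IH1 A).
- exact: (cross p q A B pq ij (s1 _ A1) (s2 _ B2)).
- by apply: (cross q p A B _ ij (s2 _ A2) (s1 _ B1)); rewrite // eq_sym.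
- exact: (IH2 A).
Qed.

(** * Existence of triangulations *)

Lemma triangulation_cut S i j T1 T2 : i \in S -> j \in S -> i != j ->
  2 < #|S :&: cyc_itv i j| -> 2 < #|S :&: cyc_itv j i| ->
  triangulation (S :&: cyc_itv i j) T1 -> triangulation (S :&: cyc_itv j i) T2 ->
  triangulation S (T1 :|: T2).
Proof.
move=> iS jS ij c1 c2 [d1 h1] [d2 h2]; split; first exact: (dissection_cut iS jS).
by move=> t; rewrite finset.in_setU => /orP[/h1|/h2].
Qed.

Lemma cyc_itv_cover i j v : i != j -> v \notin cyc_itv i j -> v \in cyc_itv j i.
Proof.
rewrite -val_eqE !in_cyc_itv /= => ij.
by case: (leqP i j) => ?; case: (leqP j i) => ?; lia.
Qed.

Lemma cyc_itvl i j : i \in cyc_itv i j.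
Proof. by rewrite in_cyc_itv leqnn; case: (leqP i j). Qed.

Lemma cyc_itvr i j : j \in cyc_itv i j.
Proof. by rewrite in_cyc_itv leqnn orbT; case: (leqP i j). Qed.

Lemma triangulation_exists S : 2 <= #|S| -> exists T, triangulation S T.
Proof.
have [m] := ubnP #|S|; elim: m S => // m IH S Sm S2.
have [S3|S4] := leqP #|S| 3.
  exists [set S]%SET; split; first exact: dissection_whole.
  by move=> t; rewrite finset.in_set1 => /eqP->.
have /card_gt0P[x0 x0S] : 0 < #|S| by apply: leq_trans S2.
have [a aS amin] := arg_minnP (fun x : 'I_n => x : nat) x0S.
have [c cS cmax] := arg_maxnP (fun x : 'I_n => x : nat) x0S.
have {}aS : a \in S := aS; have {}cS : c \in S := cS.
(* The cut will be (a, w): [u] is a third vertex on one side and [c] on the other, and each is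
   missing from the opposite side, so both parts are smaller polygons. *)
have [u [w [uS wS]]] : exists u w, [/\ u \in S, w \in S & [&& a < u, u < w & w < c]].
  have /card_gt1P[u [w []]] : 1 < #|S :\: [set a; c]|.
    have := cardsD S [set a; c].
    have := subset_leq_card (finset.subsetIr S [set a; c]).
    by rewrite cards2; case: (a != c); lia.
  rewrite !finset.in_setD !finset.in_set2 !negb_or -!val_eqE /=.
  move=> /andP[/andP[ua uc] uS] /andP[/andP[wa wc] wS] uw.
  have := amin _ uS; have := amin _ wS; have := cmax _ uS; have := cmax _ wS => *.
  have [lt|lt|eq] := ltngtP u w; last by rewrite eq eqxx in uw.
    by exists u, w; split=> //; lia.
  by exists w, u; split=> //; lia.
case/and3P=> au uw wc; have aw := ltn_trans au uw.
have wa : (w <= a) = false by rewrite leqNgt aw.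
have awE : a != w by rewrite -val_eqE /= (ltn_eqF aw).
have cut (x y z v : 'I_n) (X : {set 'I_n}) : x \in S :&: X -> y \in S :&: X ->
    z \in S :&: X -> v \in S -> v \notin X -> x < y -> y < z ->
    2 < #|S :&: X| < #|S|.
  move=> xX yX zX vS vX xy yz; apply/andP; split.
    apply: (@inner_card_gt2 _ y); apply/innerP.
    by split=> //; [exists x|exists z].
  apply: proper_card; apply/fintype.properP.
  by split; [exact: finset.subsetIl
            |exists v => //; rewrite finset.in_setI (negPf vX) andbF].
have /andP[c1 l1] : 2 < #|S :&: cyc_itv a w| < #|S|.
  apply: (cut a u w c) => //;
    by rewrite ?finset.in_setI ?aS ?uS ?wS /= in_cyc_itv (ltnW aw); lia.
have /andP[c2 l2] : 2 < #|S :&: cyc_itv w a| < #|S|.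
  apply: (cut a w c u) => //;
    by rewrite ?finset.in_setI ?aS ?uS ?wS ?cS /= in_cyc_itv wa; lia.
have [||T1 t1] := IH (S :&: cyc_itv a w); [exact: leq_trans l1 _|exact: ltnW|].
have [||T2 t2] := IH (S :&: cyc_itv w a); [exact: leq_trans l2 _|exact: ltnW|].
by exists (T1 :|: T2)%SET; exact: (triangulation_cut aS wS).
Qed.

(** If (i, j) is a diagonal of [S], cut along it first; otherwise one side contains only i and j,
    [S] lies entirely on the other, and any triangulation works. *)
Lemma triangulation_avoiding S i j : i \in S -> j \in S -> i != j ->
  exists2 T, triangulation S T & chord_avoids T i j.
Proof.
move=> iS jS ij.
have S2 : 1 < #|S| by apply/card_gt1P; exists i, j.
have small (p q : 'I_n) : p \in S -> q \in S -> p != q ->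
    #|S :&: cyc_itv p q| <= 2 -> S \subset cyc_itv q p.
  move=> pS qS pq le2; apply/fintype.subsetP => x xS.
  apply/negPn/negP => xN.
  have xpq : x \in cyc_itv p q by apply: cyc_itv_cover xN; rewrite eq_sym.
  have : #|x |: [set p; q]| <= 2.
    apply: leq_trans le2; apply/subset_leq_card/fintype.subsetP => y.
    rewrite !inE => /or3P[]/eqP->; rewrite ?xS ?pS ?qS /=;
    by [rewrite inE in xpq|have := cyc_itvl p q; rewrite inE|have := cyc_itvr p q; rewrite inE].
  rewrite cardsU1 cards2 pq finset.in_set2.
  have xp : x != p by apply: contraNneq xN => ->; exact: cyc_itvr.
  have xq : x != q by apply: contraNneq xN => ->; exact: cyc_itvl.
  by rewrite (negPf xp) (negPf xq).
have [le1|c1] := leqP #|S :&: cyc_itv i j| 2.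
  have [T tT] := triangulation_exists S2; exists T => // t tin; right.
  exact: fintype.subset_trans (dissection_sub tT.1 tin) (small i j iS jS ij le1).
have [le2|c2] := leqP #|S :&: cyc_itv j i| 2.
  have [T tT] := triangulation_exists S2; exists T => // t tin; left.
  apply: fintype.subset_trans (dissection_sub tT.1 tin) (small j i jS iS _ le2).
  by rewrite eq_sym.
have [T1 t1] := triangulation_exists (ltnW c1).
have [T2 t2] := triangulation_exists (ltnW c2).
exists (T1 :|: T2)%SET; first exact: (triangulation_cut iS jS).
move=> t; rewrite finset.in_setU => /orP[/(dissection_sub t1.1)|/(dissection_sub t2.1)].
  by rewrite finset.subsetI => /andP[_]; left.
by rewrite finset.subsetI => /andP[_]; right.
Qed.

End Dissections.

(** * Black triangles and their middle vertices *)

Section BlackVertices.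
Context {n : nat} (sigma : bicolored_subdivision n).
Implicit Types (i j v : 'I_n) (T : {set {set 'I_n}}).

(** The set B(sigma), defined without choosing a triangulation of the black polygons. *)
Definition black_inner : {set 'I_n} := (\bigcup_(B in black sigma) inner B)%SET.

Lemma black_dissection B : B \in black sigma -> B \in black sigma :|: white sigma.
Proof. by rewrite finset.in_setU => ->. Qed.

(* A black triangle is recorded by its middle vertex; the chord i -> j, i < j,
   has a triangle to its left exactly when the middle vertex is in ]i, j[. *)
Lemma card_triangles_left T i j : black_triangulation sigma T ->
  chord_avoids T i j -> i < j ->
  #|[set t in triangles T | t \subset cyc_itv i j]%SET| =
  #|[set v in black_inner | i < v < j]%SET|.
Proof.
case=> tr trB -> avoid ltij; set T' := (\bigcup_(B in _) _)%SET in avoid *.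
have T'P t : reflect (exists2 B, B \in black sigma & t \in tr B) (t \in T').
  exact: bigcupP.
(* A common inner vertex first identifies the black polygons containing [t] and [t'], then the two
   triangles inside that polygon. *)
have inj t t' v : t \in T' -> t' \in T' -> v \in inner t -> v \in inner t' -> t = t'.
  move=> /T'P[B bB tB] /T'P[B' bB' tB'] vt vt'.
  have [dB _] := trB _ bB; have [dB' _] := trB _ bB'.
  have vB := fintype.subsetP (innerS (dissection_sub dB tB)) _ vt.
  have vB' := fintype.subsetP (innerS (dissection_sub dB' tB')) _ vt'.
  have eB : B = B'.
    by apply: (dissection_inner_inj (bicolored_dissection sigma) _ _ vB vB');
      exact: black_dissection.
  by rewrite -eB in tB'; exact: (dissection_inner_inj dB tB tB' vt vt').
pose mid t : option 'I_n := [pick v in inner t].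
have midP t : t \in triangles T' -> exists2 v, mid t = Some v & inner t = [set v]%SET.
  rewrite finset.in_set => /andP[_ /eqP /inner_triangle[v vE]]; exists v => //.
  rewrite /mid vE; case: pickP => [w|/(_ v)]; rewrite finset.in_set1 ?eqxx //.
  by move=> /eqP->.
pose X := [set t in triangles T' | t \subset cyc_itv i j]%SET.
pose Y := [set v in black_inner | i < v < j]%SET; rewrite -/X -/Y.
have midX : {in X &, injective mid}.
  move=> t t'; rewrite !finset.in_set => /andP[+ _] /andP[+ _].
  move=> /andP[tT t3] /andP[tT' t3'].
  have [|v -> vE] := midP t; first by rewrite finset.in_set tT.
  have [|v' -> vE'] := midP t'; first by rewrite finset.in_set tT'.
  move=> -[vv'].
  by apply: (inj _ _ v tT tT'); rewrite ?vE ?vE' ?vv' finset.set11.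
have inS : injective (@Some 'I_n) by move=> ? ? [].
rewrite -(card_in_imset midX) -(card_imset Y inS).
congr #|pred_of_set _|; apply/finset.setP => o; apply/imsetP/imsetP.
  case=> t; rewrite finset.in_set => /andP[tT tij] ->.
  have [v -> vE] := midP _ tT; exists v => //.
  have vt : v \in inner t by rewrite vE finset.set11.
  move: tT; rewrite !finset.in_set => /andP[/T'P[B bB tB] _]; apply/andP; split.
    apply/bigcupP; exists B => //.
    exact: fintype.subsetP (innerS (dissection_sub (trB _ bB).1 tB)) _ vt.
  have /innerP[_ [a /(fintype.subsetP tij) + av] [c /(fintype.subsetP tij) + vc]] := vt.
  by rewrite !in_cyc_itv (ltnW ltij); lia.
case=> v; rewrite finset.in_set => /andP[/bigcupP[B bB vB] vij] ->.
have [dB tB3] := trB _ bB; have [t tB vt] := dissection_inner_cover dB vB.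
have tT : t \in T' by apply/T'P; exists B.
have tT3 : t \in triangles T'.
  by rewrite finset.in_set tT eqn_leq (inner_card_gt2 vt) tB3.
exists t; last first.
  have [w -> wE] := midP _ tT3; congr Some; apply/eqP.
  by rewrite wE finset.in_set1 in vt.
rewrite finset.in_set tT3; case: (avoid _ tT) => // /fintype.subsetP tji.
have /innerP[/tji + _ _] := vt.
by rewrite in_cyc_itv leqNgt ltij /=; lia.
Qed.

(** Ensures that [is_area] is not vacuous on compatible arcs. The polygon containing the chord is
    triangulated along it; every other polygon lies on one side of it. *)
Lemma black_triangulation_avoiding i j : compatible_arc sigma i j ->
  exists2 T, black_triangulation sigma T & chord_avoids T i j.
Proof.
case=> ij [A As [iA jA]].
have trE B : exists T, B \in black sigma -> triangulation B T /\ chord_avoids T i j.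
  (* [choice] needs a value for every set; the empty one serves for those that are not black. *)
  have [bB|] := boolP (B \in black sigma); last by exists finset.set0.
  have Bs := black_dissection bB; have [AB|AB] := eqVneq A B.
    rewrite -AB; have [T tT aT] := triangulation_avoiding iA jA ij.
    by exists T.
  have [T tT] := triangulation_exists (dissection_card (bicolored_dissection sigma) Bs).
  exists T => _; split=> // t /(dissection_sub tT.1) tB.
  have [s|s] := dissection_chord (bicolored_dissection sigma) As Bs AB ij iA jA.
    by left; exact: fintype.subset_trans s.
  by right; exact: fintype.subset_trans s.
have [tr trP] := choice trE.
exists (\bigcup_(B in black sigma) tr B)%SET.
  by exists tr => // B /trP[].
by move=> t /bigcupP[B /trP[_ aB] /aB].
Qed.

End BlackVertices.

(** * Counting elements between two vertices *)

Section Gaps.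
Context {n : nat}.
Implicit Types (i j v : 'I_n) (S : {set 'I_n}).

Definition card_gap S i j : nat := #|[set v in S | i < v < j]%SET|.

Lemma card_sep_sum S (P : pred 'I_n) : #|[set v in S | P v]%SET| = \sum_(v in S) P v.
Proof.
rewrite -sum1dep_card big_mkcondr; apply: eq_bigr => v _.
by case: (P v).
Qed.

Lemma sum_eq_in S j : \sum_(v in S) (v == j) = (j \in S).
Proof.
rewrite -card_sep_sum; have [jS|jS] := boolP (j \in S).
  rewrite (_ : [set v in S | v == j]%SET = [set j]%SET) ?cards1 //.
  by apply/finset.setP => v; rewrite !inE andbC; case: eqP => [->|].
apply/eqP; rewrite cards_eq0; apply/eqP/finset.setP => v; rewrite !inE andbC.
by case: eqP => [->|//]; rewrite (negPf jS).
Qed.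

Lemma card_gap_split S (a v c : 'I_n) : a < v -> v < c ->
  card_gap S a c = card_gap S a v + card_gap S v c + (v \in S).
Proof.
move=> av vc; rewrite /card_gap !card_sep_sum -sum_eq_in -!big_split /=.
apply: eq_bigr => u _; rewrite -val_eqE /=.
by case: (ltngtP a u); case: (ltngtP u v); case: (ltngtP u c); case: (ltngtP v u) => //=; lia.
Qed.

Lemma card_gap_le S i j : card_gap S i j <= #|S|.
Proof.
by apply/subset_leq_card/fintype.subsetP => v; rewrite finset.in_set => /andP[].
Qed.

(** The area predicted by [S]: of the [k] black triangles, those left of a backward arc are the ones
    not left of the reversed arc. The truncated subtraction is exact when [#|S| = k]. *)
Definition arc_gap S (k : nat) i j : nat :=
  if i < j then card_gap S i j else k - card_gap S j i.

Lemma in_inner_setT v : (v \in inner [set: 'I_n]) = (0 < v < n.-1).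
Proof.
apply/idP/idP => [/innerP[_ [a _ av] [c _ vc]]|/andP[v0 vn]].
  by have := ltn_ord c; lia.
have n0 : 0 < n by lia.
have n1 : n.-1 < n by lia.
pose o0 : 'I_n := Ordinal n0; pose o1 : 'I_n := Ordinal n1.
by apply/innerP; split; rewrite ?finset.in_setT //; [exists o0|exists o1];
  rewrite ?finset.in_setT.
Qed.

Lemma card_inner_setT : #|inner [set: 'I_n]| = n - 2.
Proof.
have [n2|n2] := leqP n 2.
  rewrite (_ : n - 2 = 0); last by lia.
  apply/eqP; rewrite cards_eq0; apply/eqP/finset.setP => v.
  by rewrite in_inner_setT finset.in_set0; lia.
have n0 : 0 < n by lia.
have n1 : n.-1 < n by lia.
rewrite (_ : inner [set: 'I_n] = ~: [set Ordinal n0; Ordinal n1]).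
  rewrite cardsCs finset.setCK card_ord cards2 -val_eqE /=.
  by rewrite (_ : (0 != n.-1) = true); lia.
apply/finset.setP => v; rewrite in_inner_setT finset.in_setC finset.in_set2 -!val_eqE /=.
by have := ltn_ord v; lia.
Qed.

End Gaps.

(** * Areas in terms of middle vertices *)

Section Areas.
Context {n : nat} (sigma : bicolored_subdivision n).
Implicit Types (i j v : 'I_n) (T : {set {set 'I_n}}).

Lemma black_inner_sub : black_inner sigma \subset inner [set: 'I_n].
Proof. by apply/bigcupsP => B _; apply/innerS/finset.subsetT. Qed.

Lemma black_triangulation_exists : exists T, black_triangulation sigma T.
Proof.
have trE B : exists T, B \in black sigma -> triangulation B T.
  have [bB|] := boolP (B \in black sigma); last by exists finset.set0.
  have [T tT] := triangulation_exists
    (dissection_card (bicolored_dissection sigma) (black_dissection bB)).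
  by exists T.
have [tr trP] := choice trE.
by exists (\bigcup_(B in black sigma) tr B)%SET; exists tr.
Qed.

(** The arc from the first to the last vertex has the whole polygon on its left, so it counts all
    black triangles. *)
Lemma card_black_inner k : 1 < n -> has_type sigma k -> #|black_inner sigma| = k.
Proof.
move=> n2 typ; have [T bT] := black_triangulation_exists.
have n0 : 0 < n by lia.
have n1 : n.-1 < n by lia.
pose o0 := Ordinal n0; pose o1 := Ordinal n1.
have full (t : {set 'I_n}) : t \subset cyc_itv o0 o1.
  by apply/fintype.subsetP => v _; rewrite in_cyc_itv /=; have := ltn_ord v; lia.
have := @card_triangles_left _ sigma T o0 o1 bT.
have -> : [set v in black_inner sigma | o0 < v < o1]%SET = black_inner sigma.
  apply/finset.setP => v; rewrite finset.in_set andb_idr //.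
  by move=> /(fintype.subsetP black_inner_sub); rewrite in_inner_setT.
have -> : [set t in triangles T | t \subset cyc_itv o0 o1]%SET = triangles T.
  by apply/finset.setP => t; rewrite finset.in_set full andbT.
rewrite (typ T bT) => <- //; first by move=> t _; left.
by rewrite /=; lia.
Qed.

Lemma card_triangles_arc k T i j : has_type sigma k -> black_triangulation sigma T ->
  chord_avoids T i j -> i != j ->
  #|[set t in triangles T | t \subset cyc_itv i j]%SET| =
    arc_gap (black_inner sigma) k i j.
Proof.
move=> typ bT avoid ij; rewrite /arc_gap.
have [ltij|] := ltnP i j; first exact: card_triangles_left.
rewrite leq_eqVlt val_eqE eq_sym (negPf ij) /= => ltji.
have avoid' : chord_avoids T j i by move=> t /avoid[]; [right|left].
rewrite /card_gap -(typ T bT) -(card_triangles_left bT avoid' ltji).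
pose X := [set t in triangles T | t \subset cyc_itv j i]%SET.
have XT : X \subset triangles T.
  by apply/fintype.subsetP => t; rewrite finset.in_set => /andP[].
rewrite -/X -(finset.setIidPr XT) -cardsD; congr #|pred_of_set _|.
have ijF : (i <= j) = false by rewrite leqNgt ltji.
have one_side (t : {set 'I_n}) : #|t| = 3 ->
    t \subset cyc_itv i j -> t \subset cyc_itv j i -> False.
  move=> t3 sub sub'; have : t \subset [set i; j]%SET.
    apply/fintype.subsetP => v vt; rewrite finset.in_set2 -!val_eqE /=.
    have := fintype.subsetP sub _ vt; have := fintype.subsetP sub' _ vt.
    by rewrite !in_cyc_itv (ltnW ltji) ijF; lia.
  by move/subset_leq_card; rewrite t3 cards2 ij.
apply/finset.setP => t; rewrite finset.in_setD !finset.in_set.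
have [tT|] := boolP (t \in T); rewrite ?andbF //=.
have [t3|] := eqVneq #|t| 3; rewrite ?andbF //= andbT.
case: (avoid _ tT) => sub; rewrite sub /=.
  by apply/esym/negP; exact: one_side.
by apply/negP => sub'; exact: one_side sub' sub.
Qed.

(** The count is the same for all triangulations avoiding the chord, and one exists; so the area is
    a function of B(sigma) and [k]. *)
Lemma is_areaP k i j a : has_type sigma k -> compatible_arc sigma i j ->
  is_area sigma i j a <-> a = arc_gap (black_inner sigma) k i j.
Proof.
move=> typ cij; split=> [ar|-> T bT aT].
  have [T bT aT] := black_triangulation_avoiding cij.
  by rewrite -(ar T bT aT); apply: card_triangles_arc => //; case: cij.
by apply: card_triangles_arc => //; case: cij.
Qed.

(** Every vertex v other than the first and the last is inner to a polygon [A], with a < v < c in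
    [A]. The arcs a -> c, a -> v and v -> c are compatible, and their three counts decide whether v
    is in the set. *)
Lemma black_inner_unique (S : {set 'I_n}) : S \subset inner [set: 'I_n] ->
  (forall i j, compatible_arc sigma i j -> i < j ->
     card_gap S i j = card_gap (black_inner sigma) i j) ->
  S = black_inner sigma.
Proof.
move=> Ssub eqc; apply/finset.setP => v.
have [vT|vT] := boolP (v \in inner [set: 'I_n]); last first.
  apply/idP/idP => [/(fintype.subsetP Ssub)|/(fintype.subsetP black_inner_sub)];
  by rewrite (negPf vT).
have [A As /innerP[vA [a aA av] [c cA vc]]] :=
  dissection_inner_cover (bicolored_dissection sigma) vT.
have cmp (x y : 'I_n) : x \in A -> y \in A -> x < y -> compatible_arc sigma x y.
  move=> xA yA xy; split; first by rewrite -val_eqE /= (ltn_eqF xy).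
  by exists A.
have ac := ltn_trans av vc.
have := eqc _ _ (cmp _ _ aA cA ac) ac.
rewrite !(card_gap_split _ av vc) (eqc _ _ (cmp _ _ aA vA av) av).
rewrite (eqc _ _ (cmp _ _ vA cA vc) vc).
by move/addnI; do 2?case: (_ \in _).
Qed.

End Areas.

Local Open Scope ring_scope.

(** * The hypersimplex as a slice of the unit cube *)

Section HypersimplexBox.
Context {R : realType} {n : nat}.
Implicit Types (x y : 'rV[R]_n) (i j l : 'I_n) (m : nat).

Lemma hypersimplex_convex m x y (a b : R) : 0 <= a -> 0 <= b -> a + b = 1 ->
  hypersimplex m x -> hypersimplex m y -> hypersimplex m (a *: x + b *: y).
Proof.
move=> a0 b0 ab [w [w0 w1 ->]] [u [u0 u1 ->]].
exists (fun I => a * w I + b * u I); split.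
- by move=> I Im; rewrite addr_ge0 // mulr_ge0 ?w0 ?u0.
- by rewrite big_split /= -!mulr_sumr w1 u1 !mulr1.
- rewrite !scaler_sumr -big_split /=; apply: eq_bigr => I _.
  by rewrite !scalerA scalerDl.
Qed.

Definition fractional x : {set 'I_n} := [set i | 0 < x ord0 i < 1]%SET.

Definition in_box x : Prop := forall i, 0 <= x ord0 i <= 1.

Definition transfer x i j (a : R) : 'rV[R]_n :=
  \row_l (x ord0 l + a * (l == i)%:R - a * (l == j)%:R).

Lemma coord_sum_transfer x i j a :
  coord_sum (transfer x i j a) [set: 'I_n]%SET = coord_sum x [set: 'I_n]%SET.
Proof.
rewrite /coord_sum; under eq_bigr do rewrite mxE.
rewrite !big_split /= sumrN -!mulr_sumr.
suff d (p : 'I_n) : \sum_(l in [set: 'I_n]%SET) (l == p)%:R = 1 :> R by rewrite !d; ring.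
rewrite (bigD1 p) ?finset.in_setT //= eqxx big1 ?addr0 // => l /andP[_ /negPf->].
by [].
Qed.

Lemma transfer_fractional x i j : in_box x -> i != j ->
  i \in fractional x -> j \in fractional x ->
  exists2 a, 0 < a & in_box (transfer x i j a) /\
    (#|fractional (transfer x i j a)| < #|fractional x|)%N.
Proof.
move=> xb ij; rewrite !finset.in_set => /andP[i0 i1] /andP[j0 j1].
have ji : (j == i) = false by rewrite eq_sym (negPf ij).
(* The largest amount that can move from coordinate j to coordinate i within the box: i reaches 1 or
   j reaches 0. *)
pose a := Num.min (1 - x ord0 i) (x ord0 j).
have [a0 ai aj] : [/\ 0 < a, a <= 1 - x ord0 i & a <= x ord0 j].
  by rewrite lt_min ge_min lexx ge_min lexx orbT; split=> //; lra.
have aE : a = 1 - x ord0 i \/ a = x ord0 j.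
  by rewrite /a; case: leP; auto.
have tE l : transfer x i j a ord0 l =
    if l == i then x ord0 i + a else if l == j then x ord0 j - a else x ord0 l.
  rewrite mxE; case: eqVneq => [->|_]; first by rewrite (negPf ij) /=; ring.
  by case: eqVneq => [->|_] /=; ring.
exists a => //; split.
  move=> l; rewrite tE; case: eqVneq => [_|_]; first lra.
  by case: eqVneq => _; [lra|exact: xb].
apply: proper_card; apply/fintype.properP; split.
  apply/fintype.subsetP => l; rewrite !finset.in_set tE.
  case: eqVneq => [->|_]; first by rewrite i0 i1.
  by case: eqVneq => [->|//]; rewrite j0 j1.
case: aE => aE.
  by exists i; rewrite !finset.in_set ?i0 ?i1 // tE eqxx aE addrC subrK ltxx andbF.
by exists j; rewrite !finset.in_set ?j0 ?j1 // tE ji eqxx aE subrr ltxx.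
Qed.

Lemma integral_coord_sum x (P : pred 'I_n) : in_box x ->
  (forall l, P l -> l \notin fractional x) ->
  \sum_(l | P l) x ord0 l = #|[set l | P l & x ord0 l == 1]%SET|%:R.
Proof.
move=> xb Pf; rewrite -sum1dep_card natr_sum big_mkcondr; apply: eq_bigr => l Pl.
have := Pf l Pl; rewrite finset.in_set; have /andP[] := xb l.
rewrite le0r => /orP[/eqP-> _ _|->]; first by rewrite eq_sym oner_eq0.
by rewrite le_eqVlt => /orP[/eqP->|->//]; rewrite eqxx.
Qed.

(** Induction on the number of fractional coordinates. Without any, [x] is some e_I. Otherwise there
    are two, and [x] lies on a segment between two points of the slice with fewer fractional
    coordinates. *)
Lemma hypersimplex_box m x : in_box x -> coord_sum x [set: 'I_n]%SET = m%:R ->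
  hypersimplex m x.
Proof.
have [N] := ubnP #|fractional x|; elim: N x => // N IH x xN xb xs.
have xs' : \sum_l x ord0 l = m%:R.
  by rewrite -xs /coord_sum; apply: eq_bigl => l; rewrite finset.in_setT.
have [f0|[i iF]] := set_0Vmem (fractional x).
  have nf l : l \notin fractional x by rewrite f0 finset.in_set0.
  pose I := [set l | x ord0 l == 1]%SET.
  have Im : #|I| == m.
    by rewrite -(eqr_nat R) -xs' (integral_coord_sum xb) //; apply/eqP.
  exists (fun J => (J == I)%:R); split.
  - by move=> J _; rewrite ler0n.
  - by rewrite (bigD1 I) //= eqxx big1 ?addr0 // => J /andP[_ /negPf->].
  - rewrite (bigD1 I) //= eqxx scale1r big1 ?addr0; last first.
      by move=> J /andP[_ /negPf->]; rewrite scale0r.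
    apply/rowP => l; rewrite mxE finset.in_set.
    have := nf l; rewrite finset.in_set; have /andP[] := xb l.
    rewrite le0r => /orP[/eqP-> _ _|->]; first by rewrite eq_sym oner_eq0.
    by rewrite le_eqVlt => /orP[/eqP->|->//]; rewrite eqxx.
(* A single fractional coordinate would put the integer m strictly between c and c + 1, where c
   counts the other coordinates equal to 1. *)
have [j /andP[ji jF]] : exists j, (j != i) && (j \in fractional x).
  have [/existsP//|/existsPn no] :=
    boolP [exists j, (j != i) && (j \in fractional x)].
  have := xs'; rewrite (bigD1 i) //= (integral_coord_sum xb); last first.
    by move=> l li; have := no l; rewrite li.
  set c := #|_|; move: iF; rewrite finset.in_set => /andP[i0 i1] eqm.
  have /andP[] : (c%:R < m%:R :> R) && (m%:R < c.+1%:R :> R).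
    by rewrite -eqm -natr1; apply/andP; split; lra.
  by rewrite !ltr_nat; lia.
have ij : i != j by rewrite eq_sym.
have [a a0 [ab aN]] := transfer_fractional xb ij iF jF.
have [b b0 [bb bN]] := transfer_fractional xb ji jF iF.
have ab0 : a + b != 0 by rewrite gt_eqF // addr_gt0.
(* The ends are x + a (e_i - e_j) and x - b (e_i - e_j); with these weights the displacements
   cancel. *)
have -> : x = (b / (a + b)) *: transfer x i j a + (a / (a + b)) *: transfer x j i b.
  by apply/rowP => l; rewrite !mxE; field.
apply: hypersimplex_convex; rewrite ?divr_ge0 ?addr_ge0 ?ltW //.
- by field.
- by apply: IH => //; [apply: leq_trans aN _|rewrite coord_sum_transfer].
- by apply: IH => //; [apply: leq_trans bN _|rewrite coord_sum_transfer].
Qed.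

End HypersimplexBox.

Local Open Scope classical_set_scope.

(** * Coordinate sums over arcs *)

Section TestPoints.
Context {R : realType} {n : nat}.
Implicit Types (x : 'rV[R]_n) (i j l : 'I_n) (S : {set 'I_n}) (m : nat).

Lemma in_cyc_itv_pred i j l : (i < j)%N ->
  (l \in cyc_itv i (ord_pred j)) = (i <= l < j)%N.
Proof.
move=> ij; have := ltn_ord j => jn.
have pj : (ord_pred j : nat) = j.-1.
  by rewrite /= (_ : (j + n).-1 = j.-1 + n)%N ?modnDr ?modn_small; lia.
by rewrite in_cyc_itv pj (_ : (i <= j.-1)%N = true); lia.
Qed.

Lemma cyc_itv_pred_setC i j : (i < j)%N ->
  cyc_itv j (ord_pred i) = ~: cyc_itv i (ord_pred j).
Proof.
move=> ij; apply/finset.setP => l.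
rewrite finset.in_setC (in_cyc_itv_pred _ ij) in_cyc_itv.
have := ltn_ord j; have := ltn_ord l => ln jn.
have [i0|i0] := posnP i.
  have -> : (ord_pred i : nat) = n.-1 by rewrite /= i0 modn_small; lia.
  by rewrite (_ : (j <= n.-1)%N = true); lia.
have -> : (ord_pred i : nat) = i.-1.
  by rewrite /= (_ : (i + n).-1 = i.-1 + n)%N ?modnDr ?modn_small; lia.
by rewrite (_ : (j <= i.-1)%N = false); lia.
Qed.

Lemma coord_sum_setC x S :
  coord_sum x (~: S)%SET = coord_sum x [set: 'I_n]%SET - coord_sum x S.
Proof.
rewrite /coord_sum [X in _ = X - _](big_setID S) /= finset.setTI finset.setTD.
by rewrite addrAC subrr add0r.
Qed.

Definition increments (f : nat -> R) : 'rV[R]_n := \row_l (f l.+1 - f l).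

Lemma coord_sum_increments_itv f i j : (i < j)%N ->
  coord_sum (increments f) (cyc_itv i (ord_pred j)) = f j - f i.
Proof.
move=> ij; rewrite -(telescope_sumr f (ltnW ij)) big_geq_mkord.
rewrite (big_ord_widen_cond n (fun m => true && (i <= m)%N)
  (fun m => f m.+1 - f m)) ?(ltnW (ltn_ord j)) //.
apply: eq_big => l; last by rewrite mxE.
by rewrite in_cyc_itv_pred //.
Qed.

Lemma coord_sum_increments f :
  coord_sum (increments f) [set: 'I_n]%SET = f n - f 0%N.
Proof.
rewrite -(telescope_sumr f (leq0n n)) big_mkord.
by apply: eq_big => l; rewrite ?finset.in_setT // mxE.
Qed.

(** * The test points *)

Definition half_pow m : R := 2^-1 ^+ m.+1.

Lemma half_pow_gt0 m : 0 < half_pow m.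
Proof. by rewrite exprn_gt0 // invr_gt0. Qed.

Lemma half_powS m : half_pow m.+1 = half_pow m / 2.
Proof. by rewrite /half_pow exprSr. Qed.

Lemma half_pow_lt p q : (p < q)%N -> half_pow q < half_pow p.
Proof.
elim: q => // q IH; rewrite ltnS leq_eqVlt half_powS; have := half_pow_gt0 q.
by move=> q0 /orP[/eqP->|/IH]; lra.
Qed.

Lemma half_pow_le m : half_pow m <= 2^-1.
Proof.
case: m => [|m]; first by rewrite /half_pow expr1.
by have := half_pow_lt (ltn0Sn m); rewrite {2}/half_pow expr1 => /ltW.
Qed.

(* position S m is a point of the circle R / Z and test_point k S walks once
   around the n-gon through these points, moving forward by less than one turn
   at each step.  Each new point is nearer to 0 in R / Z than all the previous
   ones, from above if it is in S and from below otherwise, so that one more turn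
   is completed exactly when entering S; height is the lift to R. *)
Definition position S m : R :=
  if m \in [seq val v | v in S] then half_pow m else 1 - half_pow m.

Definition height S m : R := position S m + (\sum_(v in S) (v <= m)%N)%N%:R.

Lemma positionE S j : position S j = if j \in S then half_pow j else 1 - half_pow j.
Proof. by rewrite /position (fintype.mem_image val_inj). Qed.

(** In each of the four cases it suffices that [half_pow] is positive, at most 1/2 and strictly
    decreasing. *)
Lemma position_lt S i j : (i < j)%N ->
  0 < position S j - position S i + (j \in S)%:R < 1.
Proof.
move=> ij; rewrite !positionE.
have := half_pow_lt ij; have := half_pow_le i; have := half_pow_gt0 j.
by case: (j \in S); case: (i \in S) => /=; lra.
Qed.

(** Turns are counted over ]i, j]; the one at j belongs to the move bounded by [position_lt], which
    leaves the elements of ]i, j[. *)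
Lemma height_sub S i j : (i < j)%N ->
  (card_gap S i j)%:R < height S j - height S i < (card_gap S i j)%:R + 1.
Proof.
move=> ij; rewrite /height.
have -> : (\sum_(v in S) (v <= j))%N =
    (\sum_(v in S) (v <= i) + card_gap S i j + (j \in S))%N.
  rewrite /card_gap card_sep_sum -sum_eq_in -!big_split /=; apply: eq_bigr => v _.
  rewrite -val_eqE /=.
  by case: (ltngtP v i); case: (ltngtP v j) => //=; lia.
by rewrite !natrD; have := position_lt S ij; lra.
Qed.

(** The special value at m = n closes the walk: it is vertex 0 again after k + 1 turns, so the
    coordinates sum to k + 1. *)
Definition test_point (k : nat) S : 'rV[R]_n :=
  increments (fun m => if m == n then height S 0 + k.+1%:R else height S m).

Lemma coord_sum_test_point k S : (0 < n)%N ->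
  coord_sum (test_point k S) [set: 'I_n]%SET = k.+1%:R.
Proof.
by move=> n0; rewrite coord_sum_increments eqxx eq_sym gtn_eqF //; ring.
Qed.

Lemma test_point_arc k S i j : #|S| = k -> i != j ->
  (arc_gap S k i j)%:R < coord_sum (test_point k S) (cyc_itv i (ord_pred j))
    < (arc_gap S k i j)%:R + 1.
Proof.
move=> Sk ij.
have itv (p q : 'I_n) : (p < q)%N ->
    (card_gap S p q)%:R < coord_sum (test_point k S) (cyc_itv p (ord_pred q))
      < (card_gap S p q)%:R + 1.
  move=> pq; rewrite coord_sum_increments_itv // !ltn_eqF //.
  exact: height_sub.
rewrite /arc_gap; case: ltnP => [|ji]; first exact: itv.
have {ij ji} ji : (j < i)%N by rewrite ltn_neqAle ji andbT eq_sym.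
(* A backward arc is the complement of a forward one, and k + 1 minus a number in ]g, g +
   1[ lies in ]k - g, k - g + 1[. *)
rewrite cyc_itv_pred_setC // coord_sum_setC coord_sum_test_point; last first.
  exact: leq_ltn_trans (ltn_ord j).
rewrite natrB -?Sk ?card_gap_le // Sk -natr1; have := itv _ _ ji; lra.
Qed.

Lemma test_point_hypersimplex k S : (1 < n)%N -> S \subset inner [set: 'I_n]%SET ->
  #|S| = k -> hypersimplex k.+1 (test_point k S).
Proof.
move=> n1 Ssub Sk; apply: hypersimplex_box; last by rewrite coord_sum_test_point //; lia.
have n0 : (0 < n)%N by lia.
move=> i; rewrite mxE (ltn_eqF (ltn_ord i)).
(* The last coordinate closes the walk: it is k + 1 minus the climb from vertex 0 to vertex n - 1,
   and all of [S] lies between these two. *)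
have [iE|iE] := eqVneq i.+1 n.
  pose o0 : 'I_n := Ordinal n0.
  have o0i : (o0 < i)%N by rewrite /=; lia.
  have -> : height S 0 = height S o0 by [].
  have := height_sub S o0i.
  have -> : card_gap S o0 i = k.
    rewrite -Sk; congr #|pred_of_set _|; apply/finset.setP => v.
    rewrite finset.in_set andb_idr // => /(fintype.subsetP Ssub).
    by rewrite in_inner_setT /=; lia.
  by rewrite -natr1; lra.
have lt1 : (i.+1 < n)%N by rewrite ltn_neqAle iE ltn_ord.
pose j : 'I_n := Ordinal lt1.
have ij : (i < j)%N by [].
have -> : height S i.+1 = height S j by [].
have := height_sub S ij; have -> : card_gap S i j = 0%N.
  apply/eqP; rewrite cards_eq0; apply/eqP/finset.setP => v.
  by rewrite !finset.in_set /= ; lia.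
lra.
Qed.

(** * Test points and tiles *)

Lemma coord_sum_continuous S : continuous (fun x : 'rV[R]_n => coord_sum x S).
Proof.
move=> x; apply: cvg_big => [||l _]; first exact: add_continuous.
  exact: nbhs_filter.
exact: coord_continuous.
Qed.

(** Each arc sum lies strictly between consecutive integers, so the closed unit interval required by
    the tile leaves one possible area; the areas then determine the set. *)
Lemma tile_test_point k sigma S : has_type sigma k -> S \subset inner [set: 'I_n]%SET ->
  #|S| = k -> tile k sigma (test_point k S) -> S = black_inner sigma.
Proof.
move=> typ Ssub Sk [_ tP]; apply: (black_inner_unique Ssub) => i j cij ij.
have neq : i != j by case: cij.
have := tP i j _ cij ((is_areaP _ typ cij).2 erefl).
have := test_point_arc Sk neq; rewrite /arc_gap ij.
move: (coord_sum _ _) => c /andP[l1 u1] /andP[l2 u2].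
apply/eqP; rewrite eqn_leq; apply/andP.
by split; rewrite -ltnS -(ltr_nat R) -natr1; lra.
Qed.

Lemma test_point_interior k sigma : (1 < n)%N -> has_type sigma k ->
  tile_interior k (tile k sigma) (test_point k (black_inner sigma)).
Proof.
move=> n1 typ; have Sk := card_black_inner n1 typ.
set p := test_point _ _; set S := black_inner sigma in Sk p *.
split; first by rewrite /= coord_sum_test_point //; lia.
(* There are finitely many arcs, so their strict inequalities at [p] persist on a common
   neighbourhood. *)
have near_arc (ij : 'I_n * 'I_n) : \forall y \near p, ij.1 != ij.2 ->
    (arc_gap S k ij.1 ij.2)%:R < coord_sum y (cyc_itv ij.1 (ord_pred ij.2))
      < (arc_gap S k ij.1 ij.2)%:R + 1.
  case: ij => i j /=; have [->|neq] := eqVneq i j.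
    by near=> y.
  have /andP[lo up] := test_point_arc Sk neq.
  have cont := @coord_sum_continuous (cyc_itv i (ord_pred j)) p.
  near=> y => _; apply/andP; split; near: y.
    exact: (cvgr_gt _ cont).
  exact: (cvgr_lt _ cont).
have := filter_forall (nbhs_filter p) near_arc.
apply: filterS => y yP yH; split=> // i j a cij /(is_areaP _ typ cij) ->.
have neq : i != j by case: cij.
by have /andP[/ltW-> /ltW->] := yP (i, j) neq.
Unshelve. all: by end_near. Qed.

End TestPoints.

Theorem theorem5p10 (R : realType) (k n : nat) (hk : (k + 2 <= n)%N)
    (T : set (set 'rV[R]_n)) (hT : positroid_tiling k T) :
  (T #= `I_('C(n - 2, k)))%card.
Proof.
have n1 : (1 < n)%N by lia.
case: hT => tiles triv cover.
pose D := [set S : {set 'I_n} | (S \subset inner [set: 'I_n]%SET) & #|S| == k]%SET.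
have cD : #|D| = 'C(n - 2, k) by rewrite cards_draws card_inner_setT.
have tile_of S : exists G, S \in D -> T G /\ G (@test_point R n k S).
  have [|_] := boolP (S \in D); last by exists set0.
  rewrite finset.in_set => /andP[Ssub /eqP Sk].
  have : hypersimplex k.+1 (@test_point R n k S) by exact: test_point_hypersimplex.
  by rewrite -cover => -[G TG Gp]; exists G.
have [F FP] := choice tile_of.
(* A tile containing p_S comes only from subdivisions with B(sigma) = S, so the tile determines
   [S]. *)
have Funique S sigma : S \in D -> has_type sigma k -> F S = tile k sigma ->
    S = black_inner sigma.
  move=> SD typ FE; have [_] := FP _ SD; rewrite FE => Sp.
  move: SD; rewrite finset.in_set => /andP[Ssub /eqP Sk].
  exact: tile_test_point Sp.
pose e m := F (nth finset.set0 (enum D) m).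
have eD m : (m < #|D|)%N -> nth finset.set0 (enum D) m \in D.
  by move=> mD; rewrite -mem_enum mem_nth // -cardE.
have -> : T = e @` `I_#|D|.
  apply/seteqP; split=> [G TG|_ [m /eD mD <-]]; last by case: (FP _ mD).
  have [sigma typ GE] := tiles G TG; set S := black_inner sigma.
  have SD : S \in D by rewrite finset.in_set black_inner_sub (card_black_inner n1 typ) eqxx.
  (* [G] and the tile chosen for B(sigma) share the interior point p_S, hence coincide, as distinct
     tiles have disjoint interiors. *)
  exists (index S (enum D)); first by rewrite /= cardE index_mem mem_enum.
  rewrite /e nth_index ?mem_enum //; have [TF _] := FP _ SD.
  have [tau typ' FE] := tiles _ TF; apply: triv => //.
  exists (test_point k S); split; last by rewrite GE; exact: test_point_interior.
  by rewrite FE (Funique _ _ SD typ' FE); exact: test_point_interior.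
rewrite -cD; apply: inj_card_eq => m m' /set_mem /= mD /set_mem /= mD' eE.
have [Tm _] := FP _ (eD _ mD); have [sigma typ FE] := tiles _ Tm.
apply/eqP; rewrite -(nth_uniq finset.set0 (s := enum D)) ?enum_uniq -?cardE //.
(* Both subsets equal B(sigma) for the same sigma. *)
rewrite (Funique _ _ (eD _ mD) typ FE); apply/eqP/esym.
by apply: (Funique _ _ (eD _ mD') typ); rewrite -FE -[LHS]eE.
Qed.
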